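(* Let $R \in \mathbb{R}^{m \times m}$ be the data error covariance matrix. Assume that $R$ is positive definite and that $\alpha$ is a real number with $\xi^T R\, \xi \ge \alpha \|\xi\|^2$ for every $\xi \in \mathbb{R}^m$. Then all the matrices $W^{(k)} = R + \sum_{i=1}^{k} v_i v_i^T$, $0 \le k \le N$, are positive definite and satisfy $\xi^T W^{(k)} \xi \ge \alpha \|\xi\|^2$ for every $\xi \in \mathbb{R}^m$.
   Context: Setting: the analysis step of the ensemble Kalman filter, with $n$ the model state dimension, $m$ the number of observations and $N \ge 2$ the number of ensemble members. The background ensemble is $X^B = (x_1, \ldots, x_N) \in \mathbb{R}^{n \times N}$, with mean $\bar{x} = \frac{1}{N}\sum_{i=1}^N x_i$. The matrix of member deviations is $S = \frac{1}{\sqrt{N-1}}(x_1 - \bar{x}, \ldots, x_N - \bar{x}) \in \mathbb{R}^{n \times N}$. The observation operator is a matrix $H \in \mathbb{R}^{m \times n}$. Put $V = H S \in \mathbb{R}^{m \times N}$ and let $v_1, \ldots, v_N \in \mathbb{R}^m$ be the columns of $V$. The matrix $R \in \mathbb{R}^{m\times m}$ is the covariance matrix of the data errors (in particular symmetric). The sequence $W^{(0)}, \ldots, W^{(N)}$ is defined by $W^{(0)} = R$ and $W^{(k)} = W^{(k-1)} + v_k v_k^T = R + \sum_{i=1}^{k} v_i v_i^T$ for $1 \le k \le N$. The norm $\|\cdot\|$ is the Euclidean norm. *)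

(* Defs.v *)
From mathcomp Require Import all_boot all_order all_algebra.
From mathcomp Require Import reals.

Set Implicit Arguments.
Unset Strict Implicit.
Unset Printing Implicit Defensive.

Import Order.TTheory GRing.Theory Num.Theory.
Local Open Scope ring_scope.

(* The norm `|x| that the analysis library puts on matrices is the sup norm,
   so the Euclidean norm is defined here. *)
Definition eucl_norm (K : realType) (p : nat) (x : 'cV[K]_p) : K :=
  Num.sqrt (\sum_(i < p) x i 0 ^+ 2).

Definition qform (K : realType) (p : nat) (A : 'M[K]_p) (x : 'cV[K]_p) : K :=
  (x^T *m A *m x) 0 0.

(* Symmetry is part of positive definiteness: over the reals it does not follow
   from positivity of the quadratic form. *)
Definition posdefmx (K : realType) (p : nat) (A : 'M[K]_p) : Prop :=
  A \is symmetricmx /\ forall x : 'cV[K]_p, x != 0 -> 0 < qform A x.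

(* The ensemble members are the columns of X. *)
Definition ens_mean (K : realType) (n N : nat) (X : 'M[K]_(n, N)) : 'cV[K]_n :=
  N%:R^-1 *: \sum_(i < N) col i X.

Definition ens_dev (K : realType) (n N : nat) (X : 'M[K]_(n, N)) :
    'M[K]_(n, N) :=
  (Num.sqrt (N%:R - 1))^-1 *:
    \matrix_(i < n, j < N) (X i j - ens_mean X i 0).

(* Columns are indexed from 0: col i V is the mathematical v_{i+1}, so that
   the condition i < k selects v_1, ..., v_k. Intended for k <= N. *)
Definition Wmx (K : realType) (m N : nat) (R : 'M[K]_m) (V : 'M[K]_(m, N))
    (k : nat) : 'M[K]_m :=
  R + \sum_(i < N | (i < k)%N) col i V *m (col i V)^T.

(* Main.v *)
Require Import Defs.
From mathcomp Require Import all_boot all_order all_algebra.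
From mathcomp Require Import reals.

Import Order.TTheory GRing.Theory Num.Theory.
Local Open Scope ring_scope.

(** Each rank-one update adds a nonnegative term to the quadratic form: the form of [v *m v^T] at
    [x] is the square of the scalar product of [x] and [v] ([qform_mul_tr]). By additivity the form
    of [Wmx R V k] dominates that of [R] pointwise ([qform_Wmx_ge]), so any lower bound for [R],
    strict positivity or the one with [alpha], passes to it by transitivity. Symmetry survives
    because each update is symmetric ([Wmx_symmetric]). *)

(** [symmetricmx] is the hermitian predicate with sign exponent 0 and the identity as involution;
    both disappear on unfolding. *)
Lemma symmetricmxP (K : realType) (p : nat) (A : 'M[K]_p) :
  reflect (A^T = A) (A \is symmetricmx).
Proof.
apply: (iffP (is_hermitianmxP _ _ _)); rewrite expr0 scale1r map_mx_id //.
Qed.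

Lemma qformD (K : realType) (p : nat) (A B : 'M[K]_p) (x : 'cV[K]_p) :
  qform (A + B) x = qform A x + qform B x.
Proof. by rewrite /qform mulmxDr mulmxDl mxE. Qed.

Lemma qform_sum (K : realType) (p : nat) (I : Type) (r : seq I) (P : pred I)
    (A : I -> 'M[K]_p) (x : 'cV[K]_p) :
  qform (\sum_(i <- r | P i) A i) x = \sum_(i <- r | P i) qform (A i) x.
Proof. by rewrite /qform mulmx_sumr mulmx_suml summxE. Qed.

Lemma qform_mul_tr (K : realType) (p : nat) (v x : 'cV[K]_p) :
  qform (v *m v^T) x = (x^T *m v) 0 0 ^+ 2.
Proof.
(* After regrouping as [(x^T *m v) *m (v^T *m x)], the second factor is the transpose of the first;
   both are 1 by 1, so the product is a square. *)
by rewrite /qform mulmxA -mulmxA -[v^T *m x]trmxK trmx_mul trmxK mxE big_ord1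
           [in X in _ * X]mxE.
Qed.

Lemma Wmx_symmetric (K : realType) (m N : nat) (R : 'M[K]_m)
    (V : 'M[K]_(m, N)) (k : nat) :
  R \is symmetricmx -> Wmx R V k \is symmetricmx.
Proof.
move=> /symmetricmxP symR; apply/symmetricmxP.
rewrite /Wmx linearD /= symR linear_sum /=; congr (_ + _).
by apply: eq_bigr => i _; rewrite trmx_mul trmxK.
Qed.

Lemma qform_Wmx_ge (K : realType) (m N : nat) (R : 'M[K]_m)
    (V : 'M[K]_(m, N)) (k : nat) (x : 'cV[K]_m) :
  qform R x <= qform (Wmx R V k) x.
Proof.
rewrite qformD lerDl qform_sum sumr_ge0 // => i _.
by rewrite qform_mul_tr sqr_ge0.
Qed.

Theorem theorem1 (K : realType) (n m N : nat) (hN : (2 <= N)%N)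
    (X : 'M[K]_(n, N)) (H : 'M[K]_(m, n)) (R : 'M[K]_m) (alpha : K)
    (hR : posdefmx R)
    (halpha : forall xi : 'cV[K]_m,
        alpha * eucl_norm xi ^+ 2 <= qform R xi) :
  forall k : nat, (k <= N)%N ->
    posdefmx (Wmx R (H *m ens_dev X) k) /\
    forall xi : 'cV[K]_m,
      alpha * eucl_norm xi ^+ 2 <= qform (Wmx R (H *m ens_dev X) k) xi.
Proof.
move=> k _; have [symR posR] := hR; split; first split.
- exact: Wmx_symmetric.
- by move=> x x0; exact: lt_le_trans (posR x x0) (qform_Wmx_ge _ _ _ _ _ _ _).
- by move=> x; exact: le_trans (halpha x) (qform_Wmx_ge _ _ _ _ _ _ _).
Qed.
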